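(* Let $L\colon\mathcal B\rightleftarrows\mathcal A\colon R$, $L\dashv R$, be a pyramidal adjunction between $\Box$-metrized categories. For a pyramid $\mathcal P$ in $\mathcal B$, set $$L_{\#}\mathcal P=\{A\in\mathcal A\mid R(A)\in\mathcal P\}.$$ Then the following statements hold. (1) The (full) subcategory $L_{\#}\mathcal P$ is a pyramid in $\mathcal A$ and equals the downward closure of $L[\mathcal P]$, that is, $\{A\in\mathcal A\mid A\preceq L(b)\text{ for some }b\in\mathcal P\}$. (2) For pyramids $\mathcal P_n$ ($n=1,2,\dots$) and $\mathcal P$ in $\mathcal B$, $\mathcal P_n\to\mathcal P$ weakly if and only if $L_{\#}\mathcal P_n\to L_{\#}\mathcal P$ weakly. (3) The map $\mathcal P\mapsto L_{\#}\mathcal P$ is injective on pyramids of $\mathcal B$.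
   Context: A $\Box$-metrized category is a category $\mathcal C$ together with $\Box_{\mathcal C}\colon\mathcal C\times\mathcal C\to[0,+\infty)$ (on objects) that is a metric on isomorphism classes of objects. Write $A\preceq B$ if there is a morphism from $B$ to $A$. Convergence of objects is with respect to $\Box_{\mathcal C}$, and $\Box_{\mathcal C}(A,\mathcal E)=\inf_{B\in\mathcal E}\Box_{\mathcal C}(A,B)$. A pyramid in $\mathcal C$ is a full subcategory $\mathcal P$ such that: if $A\preceq B\in\mathcal P$ then $A\in\mathcal P$; if $A,B\in\mathcal P$ there is $C\in\mathcal P$ with $A\preceq C$ and $B\preceq C$; the object set of $\mathcal P$ is nonempty and $\Box_{\mathcal C}$-closed. A sequence of pyramids $\mathcal P_n$ converges weakly to a pyramid $\mathcal P$ if $\Box_{\mathcal C}(A,\mathcal P_n)\to0$ for every $A\in\mathcal P$ and $\liminf_{n}\Box_{\mathcal C}(A,\mathcal P_n)>0$ for every object $A\notin\mathcal P$. $\mathcal C$ has domination refinement if, whenever $A\preceq\overline A$ and $\overline A_n\to\overline A$, there exist $A_n\in\mathcal C$ with $A_n\preceq\overline A_n$ and $A_n\to A$. An adjunction $L\colon\mathcal B\rightleftarrows\mathcal A\colon R$, $L\dashv R$, between $\Box$-metrized categories is a pyramidal adjunction if: (i) the unit $\operatorname{id}_{\mathcal B}\to RL$ is a natural isomorphism; (ii) $\Box_{\mathcal A}(L(b),L(b'))=\Box_{\mathcal B}(b,b')$ for all $b,b'\in\mathcal B$ and $\Box_{\mathcal B}(R(A),R(A'))\leq\Box_{\mathcal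 A}(A,A')$ for all $A,A'\in\mathcal A$; (iii) $\mathcal A$ has domination refinement. *)

(* Defs.v *)
From mathcomp Require Import all_boot all_order all_algebra.
From mathcomp Require Import all_classical all_reals all_analysis.
Set Implicit Arguments.
Unset Strict Implicit.
Unset Printing Implicit Defensive.
Import Order.TTheory GRing.Theory Num.Theory.
Import numFieldNormedType.Exports.
Local Open Scope classical_set_scope.
Local Open Scope ring_scope.

Record category := Category {
  obj :> Type;
  hom : obj -> obj -> Type;
  idm : forall X, hom X X;
  compm : forall X Y Z, hom Y Z -> hom X Y -> hom X Z;
  comp_idl : forall X Y (f : hom X Y), compm (idm Y) f = f;
  comp_idr : forall X Y (f : hom X Y), compm f (idm X) = f;
  compA : forall W X Y Z (h : hom Y Z) (g : hom X Y) (f : hom W X),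
    compm h (compm g f) = compm (compm h g) f
}.
Arguments hom {c} X Y.
Arguments idm {c} X.
Arguments compm {c X Y Z} g f.

Definition is_iso (C : category) (X Y : C) (f : hom X Y) : Prop :=
  exists g : hom Y X, compm g f = idm X /\ compm f g = idm Y.

Definition isomorphic (C : category) (X Y : C) : Prop :=
  exists f : hom X Y, is_iso f.

Record functor (C D : category) := Functor {
  fobj :> C -> D;
  fmor : forall X Y : C, hom X Y -> hom (fobj X) (fobj Y);
  fmor_id : forall X : C, fmor (idm X) = idm (fobj X);
  fmor_comp : forall (X Y Z : C) (g : hom Y Z) (f : hom X Y),
    fmor (compm g f) = compm (fmor g) (fmor f)
}.
Arguments fmor {C D} F {X Y} f : rename.

Definition functor_id (C : category) : functor C C :=
  @Functor C C (fun X => X) (fun _ _ f => f) (fun _ => erefl)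
    (fun _ _ _ _ _ => erefl).

Section FunctorComp.
Variables (C D E : category) (G : functor D E) (F : functor C D).

Let fmorGF (X Y : C) (f : hom X Y) : hom (G (F X)) (G (F Y)) :=
  fmor G (fmor F f).

Let fmorGF_id (X : C) : fmorGF (idm X) = idm (G (F X)).
Proof. by rewrite /fmorGF (fmor_id F) (fmor_id G). Qed.

Let fmorGF_comp (X Y Z : C) (g : hom Y Z) (f : hom X Y) :
  fmorGF (compm g f) = compm (fmorGF g) (fmorGF f).
Proof. by rewrite /fmorGF (fmor_comp F) (fmor_comp G). Qed.

Definition functor_comp : functor C E :=
  @Functor C E (fun X => G (F X)) fmorGF fmorGF_id fmorGF_comp.

End FunctorComp.

Record nattrans (C D : category) (F G : functor C D) := NatTrans {
  component :> forall X : C, hom (F X) (G X);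
  naturality : forall (X Y : C) (f : hom X Y),
    compm (component Y) (fmor F f) = compm (fmor G f) (component X)
}.

Definition natural_isomorphism (C D : category) (F G : functor C D)
    (eta : nattrans F G) : Prop :=
  forall X : C, is_iso (eta X).

Record adjunction (B A : category) (L : functor B A) (R : functor A B) :=
  Adjunction {
    adj_unit : nattrans (functor_id B) (functor_comp R L);
    adj_counit : nattrans (functor_comp L R) (functor_id A);
    triangleL : forall b : B,
      compm (adj_counit (L b)) (fmor L (adj_unit b)) = idm (L b);
    triangleR : forall X : A,
      compm (fmor R (adj_counit X)) (adj_unit (R X)) = idm (R X)
  }.

(* [box_eq0] says that [box] separates isomorphism classes and vanishes inside
   them; with the triangle inequality, [box] is then invariant under
   isomorphism, i.e. it is a metric on isomorphism classes of objects. *)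
Record box_category (K : realType) := BoxCategory {
  carrier :> category;
  box : carrier -> carrier -> K;
  box_ge0 : forall X Y, 0 <= box X Y;
  box_eq0 : forall X Y, box X Y = 0 <-> isomorphic X Y;
  box_sym : forall X Y, box X Y = box Y X;
  box_triangle : forall X Y Z, box X Z <= box X Y + box Y Z
}.
Arguments box {K} C X Y : rename.

(* The direction is reversed: X precedes Y when there is a morphism Y -> X. *)
Definition preceq (C : category) (X Y : C) : Prop := inhabited (hom Y X).

Notation "X ⪯ Y" := (preceq X Y) (at level 70, no associativity).

Section BoxCategory.
Variables (K : realType) (C : box_category K).

Definition box_cvg (X_ : nat -> C) (X : C) : Prop :=
  box C (X_ n) X @[n --> \oo] --> (0 : K).

(* Extended-real valued, so that the infimum over the empty set is +oo and
   inferior limits of sequences of distances are meaningful without a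
   boundedness assumption. *)
Definition box_dist (X : C) (E : set C) : \bar K :=
  ereal_inf [set (box C X Y)%:E | Y in E].

Definition box_closed (E : set C) : Prop :=
  forall (X_ : nat -> C) (X : C), (forall n, E (X_ n)) -> box_cvg X_ X -> E X.

(* A full subcategory is determined by, and represented as, its set of
   objects. *)
Definition pyramid (P : set C) : Prop :=
  [/\ forall X Y : C, X ⪯ Y -> P Y -> P X,
      forall X Y : C, P X -> P Y -> exists Z : C, [/\ P Z, X ⪯ Z & Y ⪯ Z],
      P !=set0
    & box_closed P].

Definition weak_cvg (P_ : nat -> set C) (P : set C) : Prop :=
  (forall X : C, P X -> box_dist X (P_ n) @[n --> \oo] --> 0%E) /\
  (forall X : C, ~ P X -> (0 < limn_einf (fun n => box_dist X (P_ n)))%E).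

Definition domination_refinement : Prop :=
  forall (X Y : C) (Y_ : nat -> C), X ⪯ Y -> box_cvg Y_ Y ->
  exists X_ : nat -> C, (forall n, X_ n ⪯ Y_ n) /\ box_cvg X_ X.

Definition down_closure (E : set C) : set C :=
  [set X | exists2 Y, E Y & X ⪯ Y].

End BoxCategory.
Arguments domination_refinement {K} C.

Record pyramidal_adjunction (K : realType) (B A : box_category K)
    (L : functor B A) (R : functor A B) (adj : adjunction L R) : Prop :=
  PyramidalAdjunction {
    unit_iso : natural_isomorphism (adj_unit adj);
    L_isometric : forall b b' : B, box A (L b) (L b') = box B b b';
    R_nonexpansive : forall X X' : A, box B (R X) (R X') <= box A X X';
    A_refinement : domination_refinement A
  }.

(* This is L_# P; as a set of objects it depends only on the right adjoint. *)
Definition lsharp (K : realType) (B A : box_category K)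
    (R : functor A B) (P : set B) : set A :=
  [set X | P (R X)].

(* Main.v *)
Require Import Defs.
From mathcomp Require Import all_boot all_order all_algebra.
From mathcomp Require Import all_classical all_reals all_analysis.
Set Implicit Arguments.
Unset Strict Implicit.
Import Order.TTheory GRing.Theory Num.Theory.
Import numFieldNormedType.Exports.
Local Open Scope classical_set_scope.

(** The adjunction says that [R X ⪯ b] if and only if [X ⪯ L b]
    ([adj_preceq]), and invertibility of the unit says that [b] and [R (L b)]
    are isomorphic.  Hence, as far as the preorder is concerned, the objects
    [L b] stand for [B] inside [A]: a pyramid [P] contains [b] exactly when
    [lsharp R P] contains [L b] ([lsharpL]).  This gives injectivity, and it
    also produces the elements of [lsharp R P] needed to see that this set is
    nonempty, directed and generated by [L @` P]; closedness holds because [R]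
    is nonexpansive.

    For weak convergence, the metric hypotheses say that [L] preserves the
    distance to a pyramid ([box_dist_L]) and that [R] does not increase it
    ([box_dist_R_le]).  Restricting the two conditions over [A] to the objects
    [L b] therefore yields the conditions over [B].  Conversely, the condition
    on an object [X] outside [lsharp R P] follows from the one on [R X] by
    nonexpansiveness.  For an object [X] of [lsharp R P], an approximation of
    [R X] by objects of the given pyramids of [B] only approximates [L (R X)]
    in [A], not [X] itself; since [X ⪯ L (R X)], domination refinement
    transports the approximation down to [X] ([refinement_box_dist_cvg]). *)

(** * Preorder and adjunction *)

Lemma preceq_trans (C : category) (X Y Z : C) : X ⪯ Y -> Y ⪯ Z -> X ⪯ Z.
Proof. by move=> [f] [g]; exists; exact: (compm f g). Qed.

Lemma functor_preceq (C D : category) (F : functor C D) (X Y : C) :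
  X ⪯ Y -> F X ⪯ F Y.
Proof. by move=> [f]; exists; exact: (fmor F f). Qed.

Section Adjunction.
Context (B A : category) (L : functor B A) (R : functor A B).
Variable adj : adjunction L R.

Lemma preceq_LR (X : A) : X ⪯ L (R X).
Proof. by exists; exact: (adj_counit adj X). Qed.

Lemma RL_preceq (b : B) : R (L b) ⪯ b.
Proof. by exists; exact: (adj_unit adj b). Qed.

Lemma adj_preceq (X : A) (b : B) : R X ⪯ b <-> X ⪯ L b.
Proof.
split=> [Rb|XL].
  exact: preceq_trans (preceq_LR X) (functor_preceq L Rb).
exact: preceq_trans (functor_preceq R XL) (RL_preceq b).
Qed.

Hypothesis unit_isoP : natural_isomorphism (adj_unit adj).

Lemma isomorphic_RL (b : B) : isomorphic b (R (L b)).
Proof. by exists (adj_unit adj b); exact: unit_isoP. Qed.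

Lemma preceq_RL (b : B) : b ⪯ R (L b).
Proof. by have [g _] := unit_isoP b; exists. Qed.

End Adjunction.

(** * Distance to a set of objects *)

Lemma limn_einf_le (K : realType) (u v : nat -> \bar K) :
  (forall n, (u n <= v n)%E) -> (limn_einf u <= limn_einf v)%E.
Proof.
move=> uv; rewrite !limn_einf_lim; apply: lee_lim; try exact: is_cvg_einfs.
apply: nearW => n; apply: le_ereal_inf_tmp => _ [k nk <-].
by apply: ge_ereal_inf; exists (u k) => //; exists k.
Qed.

Section Distance.
Context (K : realType) (C : box_category K).

Lemma box_dist_ge0 (X : C) (E : set C) : (0 <= box_dist X E)%E.
Proof. by apply: le_ereal_inf_tmp => _ [Y _ <-]; rewrite lee_fin box_ge0. Qed.

Lemma box_dist_le (X Y : C) (E : set C) :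
  E Y -> (box_dist X E <= (box C X Y)%:E)%E.
Proof. by move=> EY; apply: ereal_inf_lbound; exists Y. Qed.

Lemma box_dist_fin_num (X : C) (E : set C) :
  E !=set0 -> box_dist X E \is a fin_num.
Proof.
move=> [Y EY]; rewrite ge0_fin_numE ?box_dist_ge0//.
by rewrite (le_lt_trans (box_dist_le X EY))// ltry.
Qed.

Lemma box_dist_cvg0_seq (E_ : nat -> set C) (X : C) :
    (forall n, E_ n !=set0) ->
    box_dist X (E_ n) @[n --> \oo] --> 0%E ->
  exists2 X_ : nat -> C, (forall n, E_ n (X_ n)) & box_cvg X_ X.
Proof.
move=> E0 dX.
(* The infimum need not be attained; the error 1/(n+1) absorbs the gap. *)
have near_inf n : exists Y, E_ n Y /\
    (box C Y X <= fine (box_dist X (E_ n)) + harmonic n)%R.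
  have [] := @lb_ereal_inf_adherent K [set (box C X Y)%:E | Y in E_ n]
    (harmonic n) (harmonic_gt0 n) (box_dist_fin_num X (E0 n)).
  move=> _ [Y EY <-] /ltW le_Y; exists Y; split=> //.
  by rewrite box_sym -lee_fin EFinD fineK// box_dist_fin_num.
have [X_ X_P] := choice near_inf.
exists X_ => [n|]; first by case: (X_P n).
have [_ dX0] := (iffLR (fine_cvgP _ _)) dX.
apply: (@squeeze_cvgr _ _ _ _ (fun=> 0%R)
  (fun n => fine (box_dist X (E_ n)) + harmonic n)%R).
- by apply: nearW => n; rewrite box_ge0 /=; case: (X_P n).
- exact: cvg_cst.
- by rewrite -[X in _ --> X](addr0 (0 : K)%R); apply: cvgD => //;
    exact: cvg_harmonic.
Qed.

(** Objects [Y_ n] of [E_ n] approximating [Y] dominate objects approximating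
    [X], and the latter stay in the downward closed sets [E_ n]. *)
Lemma refinement_box_dist_cvg (E_ : nat -> set C) (X Y : C) :
    domination_refinement C ->
    (forall n, E_ n !=set0) ->
    (forall n (Z W : C), Z ⪯ W -> E_ n W -> E_ n Z) ->
    X ⪯ Y ->
    box_dist Y (E_ n) @[n --> \oo] --> 0%E ->
  box_dist X (E_ n) @[n --> \oo] --> 0%E.
Proof.
move=> refC E0 Edown XY /(box_dist_cvg0_seq E0)[Y_ EY cvgY].
have [X_ [XY_ cvgX]] := refC X Y Y_ XY cvgY.
apply: (@squeeze_cvge _ _ _ _ (fun=> 0%E) _ (fun n => (box C (X_ n) X)%:E)).
- apply: nearW => n; rewrite box_dist_ge0/= box_sym.
  exact: box_dist_le (Edown _ _ _ (XY_ n) (EY n)).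
- exact: cvg_cst.
- exact: cvg_EFin (nearW _ _) cvgX.
Qed.

End Distance.

(** * Pyramids under a pyramidal adjunction *)

Section PyramidalAdjunction.
Context (K : realType) (B A : box_category K).
Context (L : functor B A) (R : functor A B) (adj : adjunction L R).
Hypothesis hadj : pyramidal_adjunction adj.

Lemma lsharpL (P : set B) (b : B) : pyramid P -> lsharp R P (L b) <-> P b.
Proof.
move=> [Pdown _ _ _]; split; apply: Pdown.
  exact: (preceq_RL (unit_iso hadj)).
exact: (RL_preceq adj).
Qed.

Lemma lsharp_pyramid (P : set B) : pyramid P -> pyramid (lsharp R P).
Proof.
move=> pyrP; have [Pdown Pdir [b0 Pb0] Pclosed] := pyrP; split.
- by move=> X Y XY; apply: Pdown; exact: functor_preceq.
- move=> X Y PX PY; have [b [Pb Xb Yb]] := Pdir _ _ PX PY.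
  exists (L b); split; first exact/lsharpL.
    exact/(adj_preceq adj).
  exact/(adj_preceq adj).
- by exists (L b0); exact/lsharpL.
- move=> X_ X PX cvgX; apply: (Pclosed (fun n => R (X_ n))) => //.
  apply: (@squeeze_cvgr _ _ _ _ (fun=> 0%R) (fun n => box A (X_ n) X)) => //.
    by apply: nearW => n; rewrite box_ge0 (R_nonexpansive hadj).
  exact: cvg_cst.
Qed.

Lemma lsharp_down_closure (P : set B) :
  pyramid P -> lsharp R P = down_closure (L @` P).
Proof.
move=> [Pdown _ _ _]; apply/seteqP; split=> X /=.
  by move=> PX; exists (L (R X)); [exists (R X)|exact: (preceq_LR adj)].
move=> [_ [b Pb <-]] /(adj_preceq adj) Xb.
exact: Pdown Xb Pb.
Qed.

Lemma lsharp_inj (P Q : set B) :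
  pyramid P -> pyramid Q -> lsharp R P = lsharp R Q -> P = Q.
Proof.
move=> pyrP pyrQ eqPQ; apply/seteqP; split=> b Hb.
  by apply/lsharpL => //; rewrite -eqPQ; exact/lsharpL.
by apply/lsharpL => //; rewrite eqPQ; exact/lsharpL.
Qed.

Lemma box_dist_R_le (P : set B) (X : A) :
  (box_dist (R X) P <= box_dist X (lsharp R P))%E.
Proof.
apply: le_ereal_inf_tmp => _ [Y PY <-].
by rewrite (le_trans (box_dist_le (Y := R Y) (E := P) _ PY))// lee_fin (R_nonexpansive hadj).
Qed.

(** [lsharp R P] has more objects than [L @` P], but applying [R] to any of
    them brings it back to [P] without moving it farther from [b]. *)
Lemma box_dist_L (P : set B) (b : B) :
  pyramid P -> box_dist (L b) (lsharp R P) = box_dist b P.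
Proof.
move=> pyrP; apply/eqP; rewrite eq_le; apply/andP; split.
  apply: le_ereal_inf_tmp => _ [c Pc <-].
  rewrite -(L_isometric hadj); apply: box_dist_le; exact/lsharpL.
apply: le_ereal_inf_tmp => _ [Y PY <-].
rewrite (le_trans (box_dist_le (Y := R Y) (E := P) _ PY))// lee_fin.
rewrite (le_trans (box_triangle _ (R (L b)) _))//.
rewrite (iffRL (box_eq0 _ _) (isomorphic_RL (unit_iso hadj) b)).
by rewrite add0r (R_nonexpansive hadj).
Qed.

Lemma lsharp_weak_cvg (P_ : nat -> set B) (P : set B) :
    (forall n, pyramid (P_ n)) -> pyramid P ->
  weak_cvg P_ P <-> weak_cvg (fun n => lsharp R (P_ n)) (lsharp R P).
Proof.
move=> pyrP_ pyrP.
have distL b : (fun n => box_dist (L b) (lsharp R (P_ n))) =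
    (fun n => box_dist b (P_ n)).
  by apply/funext => n; exact: box_dist_L.
split=> -[cvg_in liminf_out]; split.
- move=> X PX.
  apply: (refinement_box_dist_cvg (Y := L (R X)) (A_refinement hadj)).
  + by move=> n; have [_ _ ne0 _] := lsharp_pyramid (pyrP_ n).
  + by move=> n; have [down _ _ _] := lsharp_pyramid (pyrP_ n).
  + exact: (preceq_LR adj).
  + by rewrite distL; exact: cvg_in.
- move=> X PX; apply: lt_le_trans (liminf_out (R X) PX) _.
  by apply: limn_einf_le => n; exact: box_dist_R_le.
- by move=> b Pb; rewrite -distL; apply: cvg_in; exact/lsharpL.
- by move=> b Pb; rewrite -distL; apply: liminf_out => /(lsharpL b pyrP).
Qed.

End PyramidalAdjunction.

Unset Implicit Arguments.
Set Strict Implicit.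

Theorem theoremA7 (K : realType) (B A : box_category K)
    (L : functor B A) (R : functor A B) (adj : adjunction L R)
    (hadj : pyramidal_adjunction adj) :
  [/\ forall P : set B, pyramid P ->
        pyramid (lsharp R P) /\
        lsharp R P = down_closure (L @` P),
      forall (P_ : nat -> set B) (P : set B),
        (forall n, pyramid (P_ n)) -> pyramid P ->
        (weak_cvg P_ P <->
         weak_cvg (fun n => lsharp R (P_ n)) (lsharp R P))
    & forall P Q : set B, pyramid P -> pyramid Q ->
        lsharp R P = lsharp R Q -> P = Q].
Proof.
split.
- move=> P pyrP; split; first exact: (lsharp_pyramid hadj).
  exact: (lsharp_down_closure adj).
- exact: (lsharp_weak_cvg hadj).
- exact: (lsharp_inj hadj).
Qed.
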